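(* Let $(\gamma,\widetilde\gamma)$ be a non-helical and non-planar Bertrand pair in Euclidean 3-space ($\gamma$ the Bertrand curve, $\widetilde\gamma$ its mate). Let $\widetilde\kappa,\widetilde\tau$ be the curvature and torsion of $\widetilde\gamma$, let $'$ be the derivative with respect to the arclength $s^{*}$ of $\widetilde\gamma$, and put $\widetilde f=\widetilde\tau/\widetilde\kappa$, $\widetilde g=\widetilde\tau'/\widetilde\kappa'$. Then the binormal indicatrix $\gamma_b=B$ of the Bertrand curve $\gamma$ is a spherical helix if and only if $$\widetilde\kappa''\widetilde\kappa\,\widetilde f^{2}-3\widetilde\kappa'^{2}\,\widetilde g\,\widetilde f+\widetilde\kappa''\widetilde\kappa-3\widetilde\kappa'^{2}=0$$ holds identically.
   Context: Curves are smooth regular curves in $\mathbb{R}^3$ with non-vanishing curvature; $\gamma$ is parameterized by arclength $s$ with Frenet frame $T,N,B$, and $\widetilde\gamma$ by arclength $s^{*}$ with Frenet frame $\widetilde T,\widetilde N,\widetilde B$. The pair $(\gamma,\widetilde\gamma)$ is a Bertrand pair if there is a correspondence of points such that the principal normals at corresponding points are linearly dependent, $N=\epsilon\widetilde N$ with $\epsilon=\pm1$, and $\widetilde\gamma(s^{*})=\gamma(s)+\lambda N(s)$ with $\lambda\neq0$ constant. Non-helical means that torsion/curvature of each curve is not constant, non-planar that the torsions are non-zero; it is assumed that $\widetilde\kappa'\neq0$, $\widetilde f\neq0$ and $\widetilde g\neq\widetilde f$ at each point. The binormal indicatrix of $\gamma$ is the curve $s\mapsto B(s)$ on the unit sphere.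 A spherical helix is a curve on the sphere which is a (general) helix, i.e. the ratio of its torsion to its curvature is constant. *)

(* Defs.v *)
From Stdlib Require Import Reals.
From Coquelicot Require Import Coquelicot.
Open Scope R_scope.

(* Sums and scalar multiples of vectors are Coquelicot's [plus] and [scal]
   on the product module R * R * R. *)
Definition vec3 : Type := (R * R * R)%type.

Definition cx (v : vec3) : R := fst (fst v).
Definition cy (v : vec3) : R := snd (fst v).
Definition cz (v : vec3) : R := snd v.

Definition dot (u v : vec3) : R := cx u * cx v + cy u * cy v + cz u * cz v.

Definition enorm (v : vec3) : R := sqrt (dot v v).

Definition cross (u v : vec3) : vec3 :=
  (cy u * cz v - cz u * cy v,
   cz u * cx v - cx u * cz v,
   cx u * cy v - cy u * cx v).

Definition vDerive (c : R -> vec3) (t : R) : vec3 :=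
  (Derive (fun u => cx (c u)) t,
   Derive (fun u => cy (c u)) t,
   Derive (fun u => cz (c u)) t).

(* Frenet apparatus of a curve in an arbitrary regular parameter: the
   derivative with respect to arclength is (1 / speed) d/dt.  The sign of the
   torsion is the one for which dB/ds = - tau N.  The values are meaningful
   where the speed and the curvature do not vanish. *)
Definition speed (c : R -> vec3) (t : R) : R := enorm (vDerive c t).

Definition tangent (c : R -> vec3) (t : R) : vec3 :=
  scal (/ speed c t) (vDerive c t).

Definition curvature (c : R -> vec3) (t : R) : R :=
  enorm (vDerive (tangent c) t) / speed c t.

Definition normal (c : R -> vec3) (t : R) : vec3 :=
  scal (/ enorm (vDerive (tangent c) t)) (vDerive (tangent c) t).

Definition binormal (c : R -> vec3) (t : R) : vec3 :=
  cross (tangent c t) (normal c t).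

Definition torsion (c : R -> vec3) (t : R) : R :=
  - (dot (vDerive (binormal c) t) (normal c t) / speed c t).

(* Curves are total functions, but only their values on an open interval
   (a, b), bounded or not, are relevant. *)
Definition in_itv (a b : Rbar) (t : R) : Prop := Rbar_lt a t /\ Rbar_lt t b.

Definition smooth_on (a b : Rbar) (f : R -> R) : Prop :=
  forall (n : nat) (t : R), in_itv a b t -> ex_derive_n f n t.

Definition curve_on (a b : Rbar) (c : R -> vec3) : Prop :=
  (smooth_on a b (fun t => cx (c t)) /\
   smooth_on a b (fun t => cy (c t)) /\
   smooth_on a b (fun t => cz (c t))) /\
  (forall t, in_itv a b t -> speed c t <> 0) /\
  (forall t, in_itv a b t -> curvature c t <> 0).

Definition arclength_curve_on (a b : Rbar) (c : R -> vec3) : Prop :=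
  curve_on a b c /\ forall s, in_itv a b s -> speed c s = 1.

Definition general_helix (a b : Rbar) (c : R -> vec3) : Prop :=
  curve_on a b c /\
  exists k : R, forall t, in_itv a b t -> torsion c t / curvature c t = k.

Definition spherical_helix (a b : Rbar) (c : R -> vec3) : Prop :=
  (forall t, in_itv a b t -> enorm (c t) = 1) /\ general_helix a b c.

(* The correspondence s |-> s* is a continuous bijection [phi] from (a, b)
   onto (a', b'); it may reverse orientation. *)
Definition bertrand_pair (a b : Rbar) (c : R -> vec3)
    (a' b' : Rbar) (c' : R -> vec3) : Prop :=
  exists (phi : R -> R) (lambda eps : R),
    (forall s, in_itv a b s -> in_itv a' b' (phi s)) /\
    (forall s1 s2, in_itv a b s1 -> in_itv a b s2 ->
       phi s1 = phi s2 -> s1 = s2) /\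
    (forall u, in_itv a' b' u -> exists s, in_itv a b s /\ phi s = u) /\
    (forall s, in_itv a b s -> continuous phi s) /\
    lambda <> 0 /\
    (eps = 1 \/ eps = -1) /\
    forall s, in_itv a b s ->
      normal c s = scal eps (normal c' (phi s)) /\
      c' (phi s) = plus (c s) (scal lambda (normal c s)).

(* Main.v *)
Require Import Defs.
From Stdlib Require Import Reals Lra Lia Classical.
From Coquelicot Require Import Coquelicot.
Open Scope R_scope.

(** Write k, w for curvature and torsion, and a tilde for the mate.
    Differentiating the mate along the correspondence phi, which is
    differentiable because it is continuous and the mate is regular, shows that
    the tangents of the two curves make a constant angle, with cosine C and
    sine S.  Comparing Frenet frames gives k and w as phi' times linear
    combinations of k~ and w~, together with the affine relation
    lambda (C w~ - eps S k~) = S; hence w~'/k~' is the constant eps S / C.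
    The binormal indicatrix has torsion/curvature equal to
    sign(w) (k' w - w' k) / (k^2 + w^2)^(3/2), which in terms of the mate is a
    nonzero constant times H = k~' / (k~^2 + w~^2)^(3/2).  The displayed
    equation is H' = 0 up to a nonvanishing factor. *)

(** * Smooth functions on an interval *)

Lemma in_itv_locally (a b : Rbar) (t : R) :
  in_itv a b t -> locally t (in_itv a b).
Proof.
  intros [Ha Hb].
  exact (filter_and _ _ (open_Rbar_gt' _ _ Ha) (open_Rbar_lt' _ _ Hb)).
Qed.

Lemma in_itv_between (a b : Rbar) (x y t : R) :
  in_itv a b x -> in_itv a b y -> x <= t <= y -> in_itv a b t.
Proof.
  intros [Hax _] [_ Hyb] Ht; split.
  - apply Rbar_lt_le_trans with x; [exact Hax | apply Ht].
  - apply Rbar_le_lt_trans with y; [apply Ht | exact Hyb].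
Qed.

Lemma locally_on (a b : Rbar) (P : R -> Prop) (t : R) :
  (forall u, in_itv a b u -> P u) -> in_itv a b t -> locally t P.
Proof.
  intros HP Ht; generalize (in_itv_locally a b t Ht); now apply filter_imp.
Qed.

Lemma constant_on_of_derive_0 (a b : Rbar) (f : R -> R) :
  (forall t, in_itv a b t -> is_derive f t 0) ->
  forall x y, in_itv a b x -> in_itv a b y -> f x = f y.
Proof.
  intros Hf x y Hx Hy.
  destruct (Rtotal_order x y) as [Hxy | [Hxy | Hxy]].
  - apply (eq_is_derive f x y); [| exact Hxy].
    intros t Ht; apply Hf; now apply (in_itv_between a b x y).
  - now subst.
  - symmetry; apply (eq_is_derive f y x); [| exact Hxy].
    intros t Ht; apply Hf; now apply (in_itv_between a b y x).
Qed.

(** Bounding the order makes closure properties provable by induction on [n]: a derivative formula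
    is treated one order lower, and smoothness is recovered as the case of all [n]. *)
Definition Cn_on (a b : Rbar) (n : nat) (f : R -> R) : Prop :=
  forall k, (k <= n)%nat -> forall t, in_itv a b t -> ex_derive_n f k t.

Lemma smooth_on_Cn (a b : Rbar) (f : R -> R) :
  smooth_on a b f <-> forall n, Cn_on a b n f.
Proof.
  split.
  - intros Hf n k _ t Ht; now apply Hf.
  - intros Hf n t Ht; now apply (Hf n n).
Qed.

Lemma Derive_n_Derive (f : R -> R) (n : nat) (t : R) :
  Derive_n (Derive f) n t = Derive_n f (S n) t.
Proof.
  rewrite <- (Nat.add_1_r n), <- Derive_n_comp; reflexivity.
Qed.

(** The left order starts at one because [ex_derive_n] at order zero is [True], so it would say
    nothing about [ex_derive f t]. *)
Lemma ex_derive_n_Derive (f : R -> R) (n : nat) (t : R) :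
  ex_derive_n (Derive f) (S n) t <-> ex_derive_n f (S (S n)) t.
Proof.
  change (ex_derive (Derive_n (Derive f) n) t
          <-> ex_derive (Derive_n f (S n)) t).
  split; apply ex_derive_ext; intros u; now rewrite Derive_n_Derive.
Qed.

Lemma Cn_on_S (a b : Rbar) (n : nat) (f : R -> R) :
  Cn_on a b (S n) f <->
  (forall t, in_itv a b t -> ex_derive f t) /\ Cn_on a b n (Derive f).
Proof.
  split.
  - intros Hf; split.
    + intros t Ht; apply (Hf 1%nat); [lia | exact Ht].
    + intros [| k] Hk t Ht; [exact I |].
      apply (proj2 (ex_derive_n_Derive f k t)), Hf; [lia | exact Ht].
  - intros [H1 Hf] [| [| k]] Hk t Ht; [exact I | now apply H1 |].
    apply (proj1 (ex_derive_n_Derive f k t)), Hf; [lia | exact Ht].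
Qed.

Lemma Cn_on_pred (a b : Rbar) (n : nat) (f : R -> R) :
  Cn_on a b (S n) f -> Cn_on a b n f.
Proof. intros Hf k Hk; apply Hf; lia. Qed.

Lemma Cn_on_ext (a b : Rbar) (n : nat) (f g : R -> R) :
  (forall t, in_itv a b t -> f t = g t) -> Cn_on a b n f -> Cn_on a b n g.
Proof.
  intros Hfg Hf k Hk t Ht.
  apply (ex_derive_n_ext_loc f); [| now apply Hf].
  now apply (locally_on a b).
Qed.

(** Induction step for the closure properties: exhibit the derivative explicitly, then treat that
    formula at order [n]. *)
Lemma Cn_on_is_derive (a b : Rbar) (n : nat) (f f' : R -> R) :
  (forall t, in_itv a b t -> is_derive f t (f' t)) ->
  Cn_on a b n f' -> Cn_on a b (S n) f.
Proof.
  intros Hd Hf; apply Cn_on_S; split.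
  - intros t Ht; exists (f' t); now apply Hd.
  - apply (Cn_on_ext a b n f'); [| exact Hf].
    intros t Ht; symmetry; now apply is_derive_unique, Hd.
Qed.

Lemma Cn_on_0 (a b : Rbar) (f : R -> R) : Cn_on a b 0 f.
Proof. intros k Hk; replace k with 0%nat by lia; now intros. Qed.

Lemma Cn_on_const (a b : Rbar) (n : nat) (c : R) : Cn_on a b n (fun _ => c).
Proof.
  revert c; induction n as [| n IH]; intros c; [apply Cn_on_0 |].
  apply Cn_on_is_derive with (fun _ => 0); [| apply IH].
  intros t _; apply (is_derive_const c).
Qed.

Lemma Cn_on_plus (a b : Rbar) (n : nat) (f g : R -> R) :
  Cn_on a b n f -> Cn_on a b n g -> Cn_on a b n (fun t => f t + g t).
Proof.
  revert f g; induction n as [| n IH]; intros f g Hf Hg; [apply Cn_on_0 |].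
  apply Cn_on_S in Hf; apply Cn_on_S in Hg.
  apply Cn_on_is_derive with (fun t => Derive f t + Derive g t).
  - intros t Ht; apply (is_derive_plus f g); apply Derive_correct.
    + now apply Hf.
    + now apply Hg.
  - now apply IH.
Qed.

Lemma Cn_on_mult (a b : Rbar) (n : nat) (f g : R -> R) :
  Cn_on a b n f -> Cn_on a b n g -> Cn_on a b n (fun t => f t * g t).
Proof.
  revert f g; induction n as [| n IH]; intros f g Hf Hg; [apply Cn_on_0 |].
  (* The product rule keeps undifferentiated factors, so [f] and [g] themselves are also needed at
     order [n]. *)
  pose proof (Cn_on_pred _ _ _ _ Hf); pose proof (Cn_on_pred _ _ _ _ Hg).
  apply Cn_on_S in Hf; apply Cn_on_S in Hg.
  apply Cn_on_is_derive with (fun t => Derive f t * g t + f t * Derive g t).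
  - intros t Ht; apply (is_derive_mult f g).
    + now apply Derive_correct, Hf.
    + now apply Derive_correct, Hg.
    + exact Rmult_comm.
  - apply Cn_on_plus; now apply IH.
Qed.

Lemma Cn_on_inv (a b : Rbar) (n : nat) (f : R -> R) :
  (forall t, in_itv a b t -> f t <> 0) ->
  Cn_on a b n f -> Cn_on a b n (fun t => / f t).
Proof.
  intros H0; induction n as [| n IH]; intros Hf; [apply Cn_on_0 |].
  pose proof (IH (Cn_on_pred _ _ _ _ Hf)) as Hi.
  apply Cn_on_S in Hf.
  (* In this form the derivative is a product whose factors [/ f t] are covered by [Hi], the result
     one order lower. *)
  apply Cn_on_is_derive with (fun t => (-1 * Derive f t) * (/ f t * / f t)).
  - intros t Ht.
    replace ((-1 * Derive f t) * (/ f t * / f t))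
      with (- Derive f t / f t ^ 2) by (field; now apply H0).
    apply is_derive_inv; [now apply Derive_correct, Hf | now apply H0].
  - apply Cn_on_mult; apply Cn_on_mult; try assumption.
    + apply Cn_on_const.
    + apply Hf.
Qed.

Lemma Cn_on_sqrt (a b : Rbar) (n : nat) (f : R -> R) :
  (forall t, in_itv a b t -> 0 < f t) ->
  Cn_on a b n f -> Cn_on a b n (fun t => sqrt (f t)).
Proof.
  intros H0; induction n as [| n IH]; intros Hf; [apply Cn_on_0 |].
  pose proof (IH (Cn_on_pred _ _ _ _ Hf)) as Hi.
  apply Cn_on_S in Hf.
  apply Cn_on_is_derive with (fun t => Derive f t * / (2 * sqrt (f t))).
  - intros t Ht; apply is_derive_sqrt; [| now apply H0].
    now apply Derive_correct, Hf.
  - apply Cn_on_mult; [apply Hf |]; apply Cn_on_inv.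
    + intros t Ht; generalize (sqrt_lt_R0 _ (H0 t Ht)); lra.
    + apply Cn_on_mult; [apply Cn_on_const | exact Hi].
Qed.

Lemma smooth_on_ex_derive (a b : Rbar) (f : R -> R) (t : R) :
  smooth_on a b f -> in_itv a b t -> ex_derive f t.
Proof. intros Hf Ht; exact (Hf 1%nat t Ht). Qed.

Lemma smooth_on_Derive (a b : Rbar) (f : R -> R) :
  smooth_on a b f -> smooth_on a b (Derive f).
Proof.
  rewrite !smooth_on_Cn; intros Hf n.
  now apply (Cn_on_S a b n f).
Qed.

Lemma smooth_on_ext (a b : Rbar) (f g : R -> R) :
  (forall t, in_itv a b t -> f t = g t) -> smooth_on a b f -> smooth_on a b g.
Proof.
  rewrite !smooth_on_Cn; intros Hfg Hf n; now apply (Cn_on_ext a b n f).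
Qed.

Lemma smooth_on_const (a b : Rbar) (c : R) : smooth_on a b (fun _ => c).
Proof. rewrite smooth_on_Cn; intros n; apply Cn_on_const. Qed.

Lemma smooth_on_plus (a b : Rbar) (f g : R -> R) :
  smooth_on a b f -> smooth_on a b g -> smooth_on a b (fun t => f t + g t).
Proof. rewrite !smooth_on_Cn; intros Hf Hg n; now apply Cn_on_plus. Qed.

Lemma smooth_on_mult (a b : Rbar) (f g : R -> R) :
  smooth_on a b f -> smooth_on a b g -> smooth_on a b (fun t => f t * g t).
Proof. rewrite !smooth_on_Cn; intros Hf Hg n; now apply Cn_on_mult. Qed.

Lemma smooth_on_opp (a b : Rbar) (f : R -> R) :
  smooth_on a b f -> smooth_on a b (fun t => - f t).
Proof.
  intros Hf; apply (smooth_on_ext a b) with (fun t => -1 * f t).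
  - intros t _; ring.
  - apply smooth_on_mult; [apply smooth_on_const | exact Hf].
Qed.

Lemma smooth_on_minus (a b : Rbar) (f g : R -> R) :
  smooth_on a b f -> smooth_on a b g -> smooth_on a b (fun t => f t - g t).
Proof. intros Hf Hg; apply smooth_on_plus, smooth_on_opp; assumption. Qed.

Lemma smooth_on_inv (a b : Rbar) (f : R -> R) :
  (forall t, in_itv a b t -> f t <> 0) ->
  smooth_on a b f -> smooth_on a b (fun t => / f t).
Proof. rewrite !smooth_on_Cn; intros H0 Hf n; now apply Cn_on_inv. Qed.

Lemma smooth_on_sqrt (a b : Rbar) (f : R -> R) :
  (forall t, in_itv a b t -> 0 < f t) ->
  smooth_on a b f -> smooth_on a b (fun t => sqrt (f t)).
Proof. rewrite !smooth_on_Cn; intros H0 Hf n; now apply Cn_on_sqrt. Qed.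

(** * Vector calculus *)

(** Convertible to the first conjunct of [curve_on], so hypotheses on curves can be used for it
    directly. *)
Definition vsmooth_on (a b : Rbar) (c : R -> vec3) : Prop :=
  smooth_on a b (fun t => cx (c t)) /\
  smooth_on a b (fun t => cy (c t)) /\
  smooth_on a b (fun t => cz (c t)).

(** Relational companion of [vDerive]: it also records differentiability, which the total function
    [vDerive] does not. *)
Definition is_vderive (c : R -> vec3) (t : R) (v : vec3) : Prop :=
  is_derive (fun u => cx (c u)) t (cx v) /\
  is_derive (fun u => cy (c u)) t (cy v) /\
  is_derive (fun u => cz (c u)) t (cz v).

Lemma vec3_eq (u v : vec3) : cx u = cx v -> cy u = cy v -> cz u = cz v -> u = v.
Proof.
  destruct u as [[? ?] ?], v as [[? ?] ?]; unfold cx, cy, cz; simpl.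
  now intros -> -> ->.
Qed.

Lemma cx_scal (l : R) (v : vec3) : cx (scal l v) = l * cx v.
Proof. reflexivity. Qed.
Lemma cy_scal (l : R) (v : vec3) : cy (scal l v) = l * cy v.
Proof. reflexivity. Qed.
Lemma cz_scal (l : R) (v : vec3) : cz (scal l v) = l * cz v.
Proof. reflexivity. Qed.
Lemma cx_plus (u v : vec3) : cx (plus u v) = cx u + cx v.
Proof. reflexivity. Qed.
Lemma cy_plus (u v : vec3) : cy (plus u v) = cy u + cy v.
Proof. reflexivity. Qed.
Lemma cz_plus (u v : vec3) : cz (plus u v) = cz u + cz v.
Proof. reflexivity. Qed.
Lemma cx_cross (u v : vec3) : cx (cross u v) = cy u * cz v - cz u * cy v.
Proof. reflexivity. Qed.
Lemma cy_cross (u v : vec3) : cy (cross u v) = cz u * cx v - cx u * cz v.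
Proof. reflexivity. Qed.
Lemma cz_cross (u v : vec3) : cz (cross u v) = cx u * cy v - cy u * cx v.
Proof. reflexivity. Qed.

Ltac vexpand :=
  unfold dot in *;
  rewrite ?cx_scal, ?cy_scal, ?cz_scal, ?cx_plus, ?cy_plus, ?cz_plus,
    ?cx_cross, ?cy_cross, ?cz_cross,
    ?cx_scal, ?cy_scal, ?cz_scal, ?cx_plus, ?cy_plus, ?cz_plus,
    ?cx_cross, ?cy_cross, ?cz_cross,
    ?cx_scal, ?cy_scal, ?cz_scal, ?cx_plus, ?cy_plus, ?cz_plus.

Lemma dot_comm (u v : vec3) : dot u v = dot v u.
Proof. unfold dot; ring. Qed.

Lemma dot_scal_l (l : R) (u v : vec3) : dot (scal l u) v = l * dot u v.
Proof. vexpand; ring. Qed.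

Lemma dot_scal_r (l : R) (u v : vec3) : dot u (scal l v) = l * dot u v.
Proof. vexpand; ring. Qed.

Lemma dot_plus_l (u v w : vec3) : dot (plus u v) w = dot u w + dot v w.
Proof. vexpand; ring. Qed.

Lemma dot_plus_r (u v w : vec3) : dot w (plus u v) = dot w u + dot w v.
Proof. vexpand; ring. Qed.

Lemma dot_ge_0 (u : vec3) : 0 <= dot u u.
Proof. unfold dot; nra. Qed.

Lemma enorm_sqr (u : vec3) : enorm u * enorm u = dot u u.
Proof. apply sqrt_sqrt, dot_ge_0. Qed.

Lemma is_vderive_unique (c : R -> vec3) (t : R) (v : vec3) :
  is_vderive c t v -> vDerive c t = v.
Proof. intros (Hx & Hy & Hz); apply vec3_eq; now apply is_derive_unique. Qed.

Lemma vsmooth_is_vderive (a b : Rbar) (c : R -> vec3) (t : R) :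
  vsmooth_on a b c -> in_itv a b t -> is_vderive c t (vDerive c t).
Proof.
  intros (Hx & Hy & Hz) Ht.
  split; [| split]; apply Derive_correct;
    now apply (smooth_on_ex_derive a b).
Qed.

Lemma is_vderive_ext_on (a b : Rbar) (c d : R -> vec3) (t : R) (v : vec3) :
  (forall u, in_itv a b u -> c u = d u) -> in_itv a b t ->
  is_vderive c t v -> is_vderive d t v.
Proof.
  intros Hcd Ht (Hx & Hy & Hz).
  split; [| split]; eapply is_derive_ext_loc; try eassumption;
    apply (locally_on a b); try exact Ht; intros u Hu; now rewrite Hcd.
Qed.

Lemma vDerive_ext_on (a b : Rbar) (c d : R -> vec3) (t : R) :
  (forall u, in_itv a b u -> c u = d u) -> in_itv a b t ->
  vDerive c t = vDerive d t.
Proof.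
  intros Hcd Ht; apply vec3_eq; apply Derive_ext_loc;
    apply (locally_on a b); try exact Ht; intros u Hu; now rewrite Hcd.
Qed.

Lemma is_derive_mult_R (f g : R -> R) (t f' g' : R) :
  is_derive f t f' -> is_derive g t g' ->
  is_derive (fun u => f u * g u) t (f' * g t + f t * g').
Proof. intros Hf Hg; apply (is_derive_mult f g); auto using Rmult_comm. Qed.

Lemma is_derive_plus_R (f g : R -> R) (t f' g' : R) :
  is_derive f t f' -> is_derive g t g' ->
  is_derive (fun u => f u + g u) t (f' + g').
Proof. exact (is_derive_plus f g t f' g'). Qed.

Lemma is_derive_minus_R (f g : R -> R) (t f' g' : R) :
  is_derive f t f' -> is_derive g t g' ->
  is_derive (fun u => f u - g u) t (f' - g').
Proof. exact (is_derive_minus f g t f' g'). Qed.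

Lemma is_derive_dot (c d : R -> vec3) (t : R) (c' d' : vec3) :
  is_vderive c t c' -> is_vderive d t d' ->
  is_derive (fun u => dot (c u) (d u)) t (dot c' (d t) + dot (c t) d').
Proof.
  intros (Hcx & Hcy & Hcz) (Hdx & Hdy & Hdz).
  replace (dot c' (d t) + dot (c t) d') with
    ((cx c' * cx (d t) + cx (c t) * cx d') +
     (cy c' * cy (d t) + cy (c t) * cy d') +
     (cz c' * cz (d t) + cz (c t) * cz d')) by (unfold dot; ring).
  apply (is_derive_plus_R
    (fun u => cx (c u) * cx (d u) + cy (c u) * cy (d u))
    (fun u => cz (c u) * cz (d u)));
    [apply (is_derive_plus_R (fun u => cx (c u) * cx (d u))
              (fun u => cy (c u) * cy (d u)));
       [apply (is_derive_mult_R (fun u => cx (c u)) (fun u => cx (d u)))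
       | apply (is_derive_mult_R (fun u => cy (c u)) (fun u => cy (d u)))]
    | apply (is_derive_mult_R (fun u => cz (c u)) (fun u => cz (d u)))];
    assumption.
Qed.

Lemma is_vderive_cross (c d : R -> vec3) (t : R) (c' d' : vec3) :
  is_vderive c t c' -> is_vderive d t d' ->
  is_vderive (fun u => cross (c u) (d u)) t
    (plus (cross c' (d t)) (cross (c t) d')).
Proof.
  intros (Hcx & Hcy & Hcz) (Hdx & Hdy & Hdz).
  split; [| split].
  - replace (cx (plus (cross c' (d t)) (cross (c t) d'))) with
      ((cy c' * cz (d t) + cy (c t) * cz d')
       - (cz c' * cy (d t) + cz (c t) * cy d')) by (vexpand; ring).
    apply (is_derive_minus_R (fun u => cy (c u) * cz (d u))
             (fun u => cz (c u) * cy (d u)));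
      [apply (is_derive_mult_R (fun u => cy (c u)))
      | apply (is_derive_mult_R (fun u => cz (c u)))]; assumption.
  - replace (cy (plus (cross c' (d t)) (cross (c t) d'))) with
      ((cz c' * cx (d t) + cz (c t) * cx d')
       - (cx c' * cz (d t) + cx (c t) * cz d')) by (vexpand; ring).
    apply (is_derive_minus_R (fun u => cz (c u) * cx (d u))
             (fun u => cx (c u) * cz (d u)));
      [apply (is_derive_mult_R (fun u => cz (c u)))
      | apply (is_derive_mult_R (fun u => cx (c u)))]; assumption.
  - replace (cz (plus (cross c' (d t)) (cross (c t) d'))) with
      ((cx c' * cy (d t) + cx (c t) * cy d')
       - (cy c' * cx (d t) + cy (c t) * cx d')) by (vexpand; ring).
    apply (is_derive_minus_R (fun u => cx (c u) * cy (d u))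
             (fun u => cy (c u) * cx (d u)));
      [apply (is_derive_mult_R (fun u => cx (c u)))
      | apply (is_derive_mult_R (fun u => cy (c u)))]; assumption.
Qed.

Lemma is_vderive_scal (f : R -> R) (c : R -> vec3) (t f' : R) (c' : vec3) :
  is_derive f t f' -> is_vderive c t c' ->
  is_vderive (fun u => scal (f u) (c u)) t
    (plus (scal f' (c t)) (scal (f t) c')).
Proof.
  intros Hf (Hx & Hy & Hz).
  split; [| split].
  - apply (is_derive_mult_R f (fun u => cx (c u))); assumption.
  - apply (is_derive_mult_R f (fun u => cy (c u))); assumption.
  - apply (is_derive_mult_R f (fun u => cz (c u))); assumption.
Qed.

Lemma is_vderive_plus (c d : R -> vec3) (t : R) (c' d' : vec3) :
  is_vderive c t c' -> is_vderive d t d' ->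
  is_vderive (fun u => plus (c u) (d u)) t (plus c' d').
Proof.
  intros (Hcx & Hcy & Hcz) (Hdx & Hdy & Hdz).
  split; [| split].
  - apply (is_derive_plus_R (fun u => cx (c u)) (fun u => cx (d u)));
      assumption.
  - apply (is_derive_plus_R (fun u => cy (c u)) (fun u => cy (d u)));
      assumption.
  - apply (is_derive_plus_R (fun u => cz (c u)) (fun u => cz (d u)));
      assumption.
Qed.

Lemma is_vderive_const (v : vec3) (t : R) :
  is_vderive (fun _ => v) t (scal 0 v).
Proof.
  split; [| split]; rewrite ?cx_scal, ?cy_scal, ?cz_scal, Rmult_0_l;
    [apply (is_derive_const (cx v)) | apply (is_derive_const (cy v))
    | apply (is_derive_const (cz v))].
Qed.

Lemma is_vderive_comp (c : R -> vec3) (f : R -> R) (t f' : R) (c' : vec3) :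
  is_vderive c (f t) c' -> is_derive f t f' ->
  is_vderive (fun u => c (f u)) t (scal f' c').
Proof.
  intros (Hx & Hy & Hz) Hf.
  split; [| split].
  - apply (is_derive_comp (fun u => cx (c u)) f); assumption.
  - apply (is_derive_comp (fun u => cy (c u)) f); assumption.
  - apply (is_derive_comp (fun u => cz (c u)) f); assumption.
Qed.

Lemma vsmooth_on_ext (a b : Rbar) (c d : R -> vec3) :
  (forall t, in_itv a b t -> c t = d t) -> vsmooth_on a b c ->
  vsmooth_on a b d.
Proof.
  intros Hcd (Hx & Hy & Hz).
  split; [| split]; [revert Hx | revert Hy | revert Hz];
    apply smooth_on_ext; intros t Ht; now rewrite Hcd.
Qed.

Lemma vsmooth_on_vDerive (a b : Rbar) (c : R -> vec3) :
  vsmooth_on a b c -> vsmooth_on a b (vDerive c).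
Proof.
  intros (Hx & Hy & Hz); repeat split; now apply smooth_on_Derive.
Qed.

Lemma vsmooth_on_scal (a b : Rbar) (f : R -> R) (c : R -> vec3) :
  smooth_on a b f -> vsmooth_on a b c ->
  vsmooth_on a b (fun t => scal (f t) (c t)).
Proof.
  intros Hf (Hx & Hy & Hz).
  split; [| split]; apply (smooth_on_mult a b f); assumption.
Qed.

Lemma vsmooth_on_cross (a b : Rbar) (c d : R -> vec3) :
  vsmooth_on a b c -> vsmooth_on a b d ->
  vsmooth_on a b (fun t => cross (c t) (d t)).
Proof.
  intros (Hcx & Hcy & Hcz) (Hdx & Hdy & Hdz).
  split; [| split]; apply smooth_on_minus; apply smooth_on_mult; assumption.
Qed.

Lemma smooth_on_dot (a b : Rbar) (c d : R -> vec3) :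
  vsmooth_on a b c -> vsmooth_on a b d ->
  smooth_on a b (fun t => dot (c t) (d t)).
Proof.
  intros (Hcx & Hcy & Hcz) (Hdx & Hdy & Hdz).
  apply smooth_on_plus; [apply smooth_on_plus |];
    apply smooth_on_mult; assumption.
Qed.

(** * Frenet equations and the binormal indicatrix *)

(* From v (B.B) = B x (v x B) + (B.v) B with B = T x N. *)
Lemma frame_expand (T N v : vec3) :
  dot T T = 1 -> dot N N = 1 -> dot T N = 0 ->
  v = plus (plus (scal (dot v T) T) (scal (dot v N) N))
        (scal (dot v (cross T N)) (cross T N)).
Proof.
  intros HT HN HTN.
  assert (E : forall r p q k : R,
    r * (dot T T * dot N N - dot T N * dot T N) =
      dot v T * (dot N N * p - dot T N * q) +
      dot v N * (dot T T * q - dot T N * p) + k -> r = dot v T * p + dot v N * q + k).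
  { intros r p q k; rewrite HT, HN, HTN; lra. }
  apply vec3_eq.
  - rewrite !cx_plus, !cx_scal; apply E; vexpand; ring.
  - rewrite !cy_plus, !cy_scal; apply E; vexpand; ring.
  - rewrite !cz_plus, !cz_scal; apply E; vexpand; ring.
Qed.

Lemma dot_cross_self_l (u v : vec3) : dot u (cross u v) = 0.
Proof. vexpand; ring. Qed.

Lemma dot_cross_self_r (u v : vec3) : dot v (cross u v) = 0.
Proof. vexpand; ring. Qed.

Lemma cross_swap (u v : vec3) : cross v u = scal (-1) (cross u v).
Proof. apply vec3_eq; vexpand; ring. Qed.

Lemma dot_cross_cross (u v w z : vec3) :
  dot (cross u v) (cross w z) = dot u w * dot v z - dot u z * dot v w.
Proof. vexpand; ring. Qed.

Lemma cross_cross_r (u v w : vec3) :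
  cross u (cross v w) = plus (scal (dot u w) v) (scal (- dot u v) w).
Proof. apply vec3_eq; vexpand; ring. Qed.

Lemma cross_cross_l (u v w : vec3) :
  cross (cross u v) w = plus (scal (dot u w) v) (scal (- dot v w) u).
Proof. apply vec3_eq; vexpand; ring. Qed.

Lemma enorm_scal (l : R) (u : vec3) :
  dot u u = 1 -> enorm (scal l u) = Rabs l.
Proof.
  intros Hu; unfold enorm; rewrite dot_scal_l, dot_scal_r, Hu, Rmult_1_r.
  apply sqrt_Rsqr_abs.
Qed.

(** Product rule for a dot product that is constant near [t]; this yields the orthogonality
    relations of the Frenet frame. *)
Lemma orthogonal_of_constant_dot (a b : Rbar) (c d : R -> vec3) (t k : R)
    (c' d' : vec3) :
  (forall u, in_itv a b u -> dot (c u) (d u) = k) -> in_itv a b t ->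
  is_vderive c t c' -> is_vderive d t d' -> dot c' (d t) + dot (c t) d' = 0.
Proof.
  intros Hk Ht Hc Hd.
  rewrite <- (is_derive_unique _ _ _ (is_derive_dot c d t c' d' Hc Hd)).
  rewrite <- (Derive_const k t); apply Derive_ext_loc.
  now apply (locally_on a b).
Qed.

(** * Frenet frame of an arclength curve *)

Section Frenet.
Variables (a b : Rbar) (c : R -> vec3).
Hypothesis Hc : arclength_curve_on a b c.
Let T := tangent c.
Let N := normal c.
Let B := binormal c.
Let k := curvature c.
Let w := torsion c.

Lemma arclength_tangent (t : R) : in_itv a b t -> vDerive c t = T t.
Proof.
  intros Ht; unfold T, tangent; rewrite (proj2 Hc t Ht), Rinv_1.
  apply vec3_eq; vexpand; ring.
Qed.

Lemma arclength_is_vderive (t : R) : in_itv a b t -> is_vderive c t (T t).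
Proof.
  intros Ht; rewrite <- (arclength_tangent t Ht).
  apply (vsmooth_is_vderive a b); [apply Hc | exact Ht].
Qed.

Lemma vsmooth_on_tangent : vsmooth_on a b T.
Proof.
  apply vsmooth_on_ext with (vDerive c); [apply arclength_tangent |].
  apply vsmooth_on_vDerive, Hc.
Qed.

Lemma tangent_unit (t : R) : in_itv a b t -> dot (T t) (T t) = 1.
Proof.
  intros Ht; rewrite <- enorm_sqr, <- (arclength_tangent t Ht).
  change (speed c t * speed c t = 1); rewrite (proj2 Hc t Ht); ring.
Qed.

Lemma arclength_curvature (t : R) :
  in_itv a b t -> enorm (vDerive T t) = k t.
Proof.
  intros Ht; unfold k, curvature; rewrite (proj2 Hc t Ht), Rdiv_1_r.
  reflexivity.
Qed.

Lemma curvature_pos (t : R) : in_itv a b t -> 0 < k t.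
Proof.
  intros Ht; destruct (Rle_lt_or_eq_dec 0 (k t)) as [H | H]; auto.
  - rewrite <- (arclength_curvature t Ht); apply sqrt_pos.
  - now elim (proj2 (proj2 (proj1 Hc)) t Ht).
Qed.

Lemma frenet_T (t : R) : in_itv a b t -> is_vderive T t (scal (k t) (N t)).
Proof.
  intros Ht; replace (scal (k t) (N t)) with (vDerive T t).
  - apply (vsmooth_is_vderive a b); [apply vsmooth_on_tangent | exact Ht].
  - unfold N, normal; fold T; rewrite (arclength_curvature t Ht).
    generalize (curvature_pos t Ht); intros Hk.
    apply vec3_eq; vexpand; field; lra.
Qed.

Lemma normal_unit (t : R) : in_itv a b t -> dot (N t) (N t) = 1.
Proof.
  intros Ht; unfold N, normal; fold T; rewrite (arclength_curvature t Ht).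
  rewrite dot_scal_l, dot_scal_r, <- enorm_sqr, (arclength_curvature t Ht).
  generalize (curvature_pos t Ht); intros Hk; field; lra.
Qed.

(** Since [T] has constant length, [T'] is orthogonal to [T]; dividing by the positive curvature
    gives the claim for [N]. *)
Lemma dot_tangent_normal (t : R) : in_itv a b t -> dot (T t) (N t) = 0.
Proof.
  intros Ht.
  pose proof (orthogonal_of_constant_dot a b T T t 1 _ _ tangent_unit Ht
    (frenet_T t Ht) (frenet_T t Ht)) as H.
  rewrite dot_scal_l, dot_scal_r, (dot_comm (N t)) in H.
  generalize (curvature_pos t Ht); intros Hk; nra.
Qed.

Lemma smooth_on_curvature : smooth_on a b k.
Proof.
  apply smooth_on_ext with (fun t => sqrt (dot (vDerive T t) (vDerive T t))).
  - exact arclength_curvature.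
  - apply smooth_on_sqrt.
    + intros t Ht; rewrite <- enorm_sqr, (arclength_curvature t Ht).
      generalize (curvature_pos t Ht); nra.
    + apply smooth_on_dot; apply vsmooth_on_vDerive, vsmooth_on_tangent.
Qed.

Lemma vsmooth_on_normal : vsmooth_on a b N.
Proof.
  apply vsmooth_on_ext with (fun t => scal (/ k t) (vDerive T t)).
  - intros t Ht; now rewrite <- (arclength_curvature t Ht).
  - apply vsmooth_on_scal; [apply smooth_on_inv |].
    + intros t Ht; generalize (curvature_pos t Ht); lra.
    + apply smooth_on_curvature.
    + apply vsmooth_on_vDerive, vsmooth_on_tangent.
Qed.

Lemma vsmooth_on_binormal : vsmooth_on a b B.
Proof.
  apply vsmooth_on_cross; [apply vsmooth_on_tangent | apply vsmooth_on_normal].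
Qed.

Lemma binormal_unit (t : R) : in_itv a b t -> dot (B t) (B t) = 1.
Proof.
  intros Ht; unfold B, binormal; fold T N.
  rewrite dot_cross_cross, (dot_comm (N t) (T t)), tangent_unit, normal_unit,
    dot_tangent_normal by exact Ht; ring.
Qed.

Lemma smooth_on_torsion : smooth_on a b w.
Proof.
  apply smooth_on_ext with (fun t => - dot (vDerive B t) (N t)).
  - intros t Ht; unfold w, torsion; rewrite (proj2 Hc t Ht), Rdiv_1_r.
    reflexivity.
  - apply smooth_on_opp, smooth_on_dot; [| apply vsmooth_on_normal].
    apply vsmooth_on_vDerive, vsmooth_on_binormal.
Qed.

(** Expand [B'] in the frame. The [N] coordinate is minus the torsion by definition, the [T]
    coordinate vanishes because [B] is orthogonal to [T] and to [T' = k N], and the [B] coordinate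
    vanishes because [B] is a unit vector. *)
Lemma frenet_B (t : R) : in_itv a b t -> is_vderive B t (scal (- w t) (N t)).
Proof.
  intros Ht.
  pose proof (vsmooth_is_vderive a b B t vsmooth_on_binormal Ht) as HB.
  replace (scal (- w t) (N t)) with (vDerive B t); [exact HB |].
  rewrite (frame_expand (T t) (N t) (vDerive B t)); auto using
    tangent_unit, normal_unit, dot_tangent_normal.
  change (cross (T t) (N t)) with (B t).
  replace (dot (vDerive B t) (N t)) with (- w t).
  2:{ unfold w, torsion; rewrite (proj2 Hc t Ht), Rdiv_1_r.
      unfold B, N; ring. }
  replace (dot (vDerive B t) (T t)) with 0.
  2:{ assert (H0 : forall u, in_itv a b u -> dot (B u) (T u) = 0).
      { intros u _; rewrite dot_comm; apply dot_cross_self_l. }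
      pose proof (orthogonal_of_constant_dot a b B T t 0 _ _ H0 Ht HB
        (frenet_T t Ht)) as H.
      rewrite dot_scal_r, (dot_comm (B t)) in H.
      replace (dot (N t) (B t)) with 0 in H
        by (symmetry; apply dot_cross_self_r).
      lra. }
  replace (dot (vDerive B t) (B t)) with 0.
  2:{ pose proof (orthogonal_of_constant_dot a b B B t 1 _ _ binormal_unit Ht
        HB HB) as H.
      rewrite (dot_comm (B t)) in H; lra. }
  apply vec3_eq; vexpand; ring.
Qed.

(** Differentiate [N = cross B T], using the equations already known for [B] and [T]. *)
Lemma frenet_N (t : R) :
  in_itv a b t ->
  is_vderive N t (plus (scal (- k t) (T t)) (scal (w t) (B t))).
Proof.
  intros Ht.
  apply (is_vderive_ext_on a b (fun u => cross (B u) (T u))); [| exact Ht |].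
  - intros u Hu; unfold B, binormal; fold T N; rewrite cross_cross_l.
    rewrite tangent_unit, (dot_comm (N u)), dot_tangent_normal by exact Hu.
    apply vec3_eq; vexpand; ring.
  - replace (plus (scal (- k t) (T t)) (scal (w t) (B t))) with
      (plus (cross (scal (- w t) (N t)) (T t))
            (cross (B t) (scal (k t) (N t)))).
    + apply is_vderive_cross; [now apply frenet_B | now apply frenet_T].
    + unfold B, binormal; fold T N.
      replace (cross (cross (T t) (N t)) (scal (k t) (N t))) with
        (scal (- k t) (T t)).
      * apply vec3_eq; vexpand; ring.
      * rewrite cross_cross_l, !dot_scal_r, normal_unit, dot_tangent_normal
          by exact Ht.
        apply vec3_eq; vexpand; ring.
Qed.

(** * Frenet apparatus of the binormal indicatrix *)

Hypothesis Hw : forall t, in_itv a b t -> w t <> 0.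

(** The sign of the torsion: the indicatrix has velocity [- w N] and speed [Rabs w]. *)
Let q (t : R) : R := w t / Rabs (w t).
(** The length of the Darboux vector [w T + k B]. *)
Let W (t : R) : R := sqrt (k t * k t + w t * w t).

Lemma darboux_pos (t : R) : in_itv a b t -> 0 < W t.
Proof.
  intros Ht; apply sqrt_lt_R0; generalize (curvature_pos t Ht); nra.
Qed.

Lemma torsion_sign_sqr (t : R) : in_itv a b t -> q t * q t = 1.
Proof.
  intros Ht; unfold q.
  replace (w t / Rabs (w t) * (w t / Rabs (w t))) with
    ((w t * w t) / (Rabs (w t) * Rabs (w t)))
    by (field; now apply Rabs_no_R0, Hw).
  rewrite <- Rabs_mult, Rabs_pos_eq by nra.
  field; now apply Hw.
Qed.

(** Where [w] does not vanish, [Rabs w] has derivative [sign w] times [w'], and the two terms in the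
    numerator of the quotient rule cancel. *)
Lemma is_derive_torsion_sign (t : R) : in_itv a b t -> is_derive q t 0.
Proof.
  intros Ht.
  pose proof (smooth_on_ex_derive a b w t smooth_on_torsion Ht) as Hd.
  apply Derive_correct in Hd.
  pose proof (is_derive_div w (fun u => Rabs (w u)) t _ _ Hd
    (is_derive_Rabs w t _ Hd (Hw t Ht)) (Rabs_no_R0 _ (Hw t Ht))) as H.
  replace 0 with
    ((Derive w t * Rabs (w t) - w t * (sign (w t) * Derive w t))
       / Rabs (w t) ^ 2); [exact H |].
  (* Only the numerator is rewritten; the denominator keeps [Rabs (w t)], whose nonvanishing is what
     [field] asks for. *)
  replace (Rabs (w t)) with (sign (w t) * w t) at 1.
  - field; now apply Rabs_no_R0, Hw.
  - generalize (Hw t Ht); intros H0.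
    destruct (Rtotal_order (w t) 0) as [Hn | [Hn | Hn]].
    + rewrite sign_eq_m1, Rabs_left by exact Hn; ring.
    + contradiction.
    + rewrite sign_eq_1, Rabs_right by lra; ring.
Qed.

Lemma speed_binormal (t : R) : in_itv a b t -> speed B t = Rabs (w t).
Proof.
  intros Ht; unfold speed.
  rewrite (is_vderive_unique _ _ _ (frenet_B t Ht)).
  rewrite enorm_scal by now apply normal_unit.
  apply Rabs_Ropp.
Qed.

Lemma tangent_binormal (t : R) :
  in_itv a b t -> tangent B t = scal (- q t) (N t).
Proof.
  intros Ht; unfold tangent; rewrite speed_binormal by exact Ht.
  rewrite (is_vderive_unique _ _ _ (frenet_B t Ht)).
  generalize (Rabs_no_R0 _ (Hw t Ht)); intros H0.
  apply vec3_eq; vexpand; unfold q; field; exact H0.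
Qed.

Lemma vDerive_tangent_binormal (t : R) :
  in_itv a b t ->
  vDerive (tangent B) t =
    scal (- q t) (plus (scal (- k t) (T t)) (scal (w t) (B t))).
Proof.
  intros Ht.
  rewrite (vDerive_ext_on a b (tangent B) (fun u => scal (- q u) (N u)))
    by (exact tangent_binormal || exact Ht).
  apply is_vderive_unique.
  pose proof (is_vderive_scal (fun u => - q u) N t _ _
    (is_derive_opp q t 0 (is_derive_torsion_sign t Ht)) (frenet_N t Ht)) as H.
  match type of H with is_vderive _ _ ?x => match goal with
    |- is_vderive _ _ ?y => replace y with x; [exact H |] end end.
  change (@opp _ 0) with (- 0).
  apply vec3_eq; vexpand; ring.
Qed.

Lemma dot_tangent_binormal (t : R) : dot (T t) (B t) = 0.
Proof. apply dot_cross_self_l. Qed.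

Lemma dot_normal_binormal (t : R) : dot (N t) (B t) = 0.
Proof. apply dot_cross_self_r. Qed.

Lemma enorm_vDerive_tangent_binormal (t : R) :
  in_itv a b t -> enorm (vDerive (tangent B) t) = W t.
Proof.
  intros Ht; rewrite vDerive_tangent_binormal by exact Ht.
  unfold enorm, W; f_equal.
  rewrite dot_scal_l, dot_scal_r, !dot_plus_l, !dot_plus_r,
    !dot_scal_l, !dot_scal_r, (dot_comm (B t) (T t)), dot_tangent_binormal,
    tangent_unit, binormal_unit by exact Ht.
  replace (k t * k t + w t * w t) with
    (q t * q t * (k t * k t + w t * w t))
    by (rewrite torsion_sign_sqr by exact Ht; ring).
  ring.
Qed.

Lemma curvature_binormal (t : R) :
  in_itv a b t -> curvature B t = W t / Rabs (w t).
Proof.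
  intros Ht; unfold curvature.
  now rewrite enorm_vDerive_tangent_binormal, speed_binormal by exact Ht.
Qed.

Lemma curve_on_binormal : curve_on a b B.
Proof.
  split; [exact vsmooth_on_binormal |]; split; intros t Ht.
  - rewrite speed_binormal by exact Ht; now apply Rabs_no_R0, Hw.
  - rewrite curvature_binormal by exact Ht.
    apply Rmult_integral_contrapositive; split.
    + generalize (darboux_pos t Ht); lra.
    + now apply Rinv_neq_0_compat, Rabs_no_R0, Hw.
Qed.

Lemma normal_binormal (t : R) :
  in_itv a b t ->
  normal B t =
    scal (- q t / W t) (plus (scal (- k t) (T t)) (scal (w t) (B t))).
Proof.
  intros Ht; unfold normal.
  rewrite enorm_vDerive_tangent_binormal, vDerive_tangent_binormal
    by exact Ht.
  generalize (darboux_pos t Ht); intros H.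
  apply vec3_eq; vexpand; field; lra.
Qed.

(** The binormal of the indicatrix is the unit Darboux vector, because [cross N T] is [- B] and
    [cross N B] is [T]. The sign [q] occurs squared and disappears. *)
Lemma binormal_binormal (t : R) :
  in_itv a b t ->
  binormal B t = scal (/ W t) (plus (scal (k t) (B t)) (scal (w t) (T t))).
Proof.
  intros Ht; unfold binormal at 1.
  rewrite normal_binormal, tangent_binormal by exact Ht.
  replace (cross (scal (- q t) (N t)) _) with
    (scal (q t * q t * / W t)
       (plus (scal (- k t) (cross (N t) (T t)))
             (scal (w t) (cross (N t) (B t))))).
  - rewrite torsion_sign_sqr by exact Ht.
    unfold B at 1, binormal; fold T N.
    rewrite cross_cross_r, normal_unit, (dot_comm (N t)), dot_tangent_normal
      by exact Ht.
    rewrite cross_swap; change (cross (T t) (N t)) with (B t).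
    apply vec3_eq; vexpand; ring.
  - generalize (darboux_pos t Ht); intros H.
    apply vec3_eq; vexpand; field; lra.
Qed.

(** Differentiate the unit Darboux vector. Its two [N] terms cancel, and pairing [k' B + w' T] with
    the direction [- k T + w B] of the indicatrix normal leaves [k' w - w' k]. *)
Lemma binormal_torsion_ratio (t : R) :
  in_itv a b t ->
  torsion B t / curvature B t =
    w t / Rabs (w t) * (Derive k t * w t - Derive w t * k t) / W t ^ 3.
Proof.
  intros Ht.
  pose proof (smooth_on_ex_derive a b w t smooth_on_torsion Ht) as Hdw.
  pose proof (smooth_on_ex_derive a b k t smooth_on_curvature Ht) as Hdk.
  (* Existence suffices: the derivative of [/ W] multiplies [k B + w T], which is orthogonal to the
     normal of the indicatrix. *)
  assert (HdW : ex_derive (fun u => / W u) t).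
  { apply (smooth_on_ex_derive a b); [| exact Ht].
    apply smooth_on_inv.
    - intros u Hu; generalize (darboux_pos u Hu); lra.
    - apply smooth_on_sqrt.
      + intros u Hu; generalize (curvature_pos u Hu); nra.
      + apply smooth_on_plus; apply smooth_on_mult;
          apply smooth_on_curvature || apply smooth_on_torsion. }
  apply Derive_correct in Hdw; apply Derive_correct in Hdk;
    apply Derive_correct in HdW.
  unfold torsion at 1.
  rewrite speed_binormal, curvature_binormal, normal_binormal by exact Ht.
  replace (vDerive (binormal B) t) with
    (plus (scal (Derive (fun u => / W u) t)
             (plus (scal (k t) (B t)) (scal (w t) (T t))))
       (scal (/ W t)
          (plus (plus (scal (Derive k t) (B t)) (scal (k t) (scal (- w t) (N t))))
             (plus (scal (Derive w t) (T t)) (scal (w t) (scal (k t) (N t))))))).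
  2:{ symmetry; apply is_vderive_unique.
      apply (is_vderive_ext_on a b (fun u =>
        scal (/ W u) (plus (scal (k u) (B u)) (scal (w u) (T u)))));
        [intros u Hu; symmetry; now apply binormal_binormal | exact Ht |].
      apply (is_vderive_scal (fun u => / W u)
        (fun u => plus (scal (k u) (B u)) (scal (w u) (T u))));
        [exact HdW |].
      apply (is_vderive_plus (fun u => scal (k u) (B u))
        (fun u => scal (w u) (T u))).
      - apply is_vderive_scal; [exact Hdk | now apply frenet_B].
      - apply is_vderive_scal; [exact Hdw | now apply frenet_T]. }
  rewrite ?dot_scal_l, ?dot_scal_r, ?dot_plus_l, ?dot_plus_r, ?dot_scal_l,
    ?dot_scal_r, ?dot_plus_l, ?dot_plus_r, ?dot_scal_l, ?dot_scal_r,
    ?dot_plus_l, ?dot_plus_r, ?dot_scal_l, ?dot_scal_r.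
  rewrite !(dot_comm (B t) (T t)), !(dot_comm (N t) (T t)),
    !dot_tangent_binormal, !dot_normal_binormal, !dot_tangent_normal,
    !tangent_unit, !binormal_unit by exact Ht.
  fold (q t).
  generalize (darboux_pos t Ht) (Rabs_no_R0 _ (Hw t Ht)); intros HW Ha.
  field; split; [lra | exact Ha].
Qed.

End Frenet.

(** * Bertrand pairs *)

(** The explicit remainder estimate, convenient for comparing increments of [phi] and of a
    composite. *)
Lemma is_derive_locally (f : R -> R) (x l : R) :
  is_derive f x l <->
  forall eps : posreal,
    locally x (fun y => Rabs (f y - f x - l * (y - x)) <= eps * Rabs (y - x)).
Proof.
  split.
  - intros [_ H] eps.
    generalize (H x (fun P HP => HP) eps); apply filter_imp; intros y Hy.
    change (Rabs (f y - f x - (y - x) * l) <= eps * Rabs (y - x)) in Hy.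
    now rewrite Rmult_comm.
  - intros H; split; [apply is_linear_scal_l |].
    intros z Hz.
    apply (is_filter_lim_locally_unique (V := AbsRing_NormedModule R_AbsRing)) in Hz.
    subst z.
    intros eps; generalize (H eps); apply filter_imp; intros y Hy.
    change (Rabs (f y - f x - (y - x) * l) <= eps * Rabs (y - x)).
    now rewrite (Rmult_comm (y - x)).
Qed.

(** A converse chain rule. As [F] has derivative 1, its increment [D] differs from the increment [d]
    of [phi] by a small multiple of [d]. Hence [d] is at most twice [D] in absolute value, so it is
    of the order of [h], and the error [D - d] is negligible against [h]. *)
Lemma is_derive_of_comp (F phi : R -> R) (s l : R) :
  continuous phi s -> is_derive F (phi s) 1 ->
  is_derive (fun t => F (phi t)) s l -> is_derive phi s l.
Proof.
  intros Hphi HF HG; apply is_derive_locally; intros eps.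
  assert (Hl : 0 < Rabs l + 1) by (generalize (Rabs_pos l); lra).
  assert (Heps := cond_pos eps).
  (* The first entries of the two minima, 1 and 1/2, give the crude bounds [A1] and [A2]; the second
     entries let each of the two error terms use at most half of [eps]. *)
  assert (H1 : 0 < Rmin 1 (eps / 2)) by (apply Rmin_case; lra).
  assert (H2 : 0 < Rmin (1 / 2) (eps / (4 * (Rabs l + 1)))).
  { apply Rmin_case; [lra |]; apply Rdiv_lt_0_compat; lra. }
  pose proof (proj1 (is_derive_locally _ _ _) HG (mkposreal _ H1)) as EG.
  (* Continuity of [phi] pulls the estimate for [F] near [phi s] back to a neighbourhood of [s]. *)
  pose proof (Hphi _ (proj1 (is_derive_locally _ _ _) HF (mkposreal _ H2)))
    as EF.
  generalize (filter_and _ _ EG EF); apply filter_imp; clear EG EF.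
  intros t [EG EF]; simpl in EG, EF.
  set (e1 := Rmin 1 (eps / 2)) in *.
  set (e2 := Rmin (1 / 2) (eps / (4 * (Rabs l + 1)))) in *.
  assert (K1 : e1 <= 1) by apply Rmin_l.
  assert (K2 : e1 <= eps / 2) by apply Rmin_r.
  assert (K3 : e2 <= 1 / 2) by apply Rmin_l.
  assert (K4 : e2 * (4 * (Rabs l + 1)) <= eps).
  { apply Rle_trans with (eps / (4 * (Rabs l + 1)) * (4 * (Rabs l + 1))).
    - apply Rmult_le_compat_r; [lra | apply Rmin_r].
    - right; field; lra. }
  set (h := t - s) in *; set (d := phi t - phi s) in *.
  set (D := F (phi t) - F (phi s)) in *.
  rewrite Rmult_1_l in EF.
  assert (A1 : Rabs D <= (Rabs l + 1) * Rabs h).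
  { replace D with ((D - l * h) + l * h) by ring.
    eapply Rle_trans; [apply Rabs_triang |]; rewrite (Rabs_mult l h).
    generalize (Rabs_pos h); nra. }
  assert (A2 : Rabs d <= 2 * Rabs D).
  { assert (Rabs d <= Rabs D + Rabs (D - d)).
    { replace d with (D + - (D - d)) at 1 by ring.
      eapply Rle_trans; [apply Rabs_triang |]; rewrite Rabs_Ropp; lra. }
    generalize (Rabs_pos d); nra. }
  replace (d - l * h) with ((D - l * h) + - (D - d)) by ring.
  eapply Rle_trans; [apply Rabs_triang |]; rewrite Rabs_Ropp.
  assert (A3 : e2 * Rabs d <= e2 * (2 * (Rabs l + 1) * Rabs h)).
  { apply Rmult_le_compat_l; lra. }
  generalize (Rabs_pos h); nra.
Qed.

(** Projecting onto the fixed vector [v] reduces to the scalar case: the projection of [c] has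
    derivative [dot v v = 1] at [phi s]. *)
Lemma is_vderive_comp_inv (c : R -> vec3) (phi : R -> R) (s : R) (v d : vec3) :
  continuous phi s -> is_vderive c (phi s) v -> dot v v = 1 ->
  is_vderive (fun t => c (phi t)) s d -> is_derive phi s (dot d v).
Proof.
  intros Hphi Hc Hv Hd.
  assert (E : forall (e : R -> vec3) (t : R) (e' : vec3), is_vderive e t e' ->
    is_derive (fun u => dot (e u) v) t (dot e' v)).
  { intros e t e' He.
    pose proof (is_derive_dot e (fun _ => v) t _ _ He (is_vderive_const v t))
      as H.
    rewrite dot_scal_r, Rmult_0_l, Rplus_0_r in H; exact H. }
  apply (is_derive_of_comp (fun u => dot (c u) v) phi); [exact Hphi | |].
  - rewrite <- Hv; now apply E.
  - now apply (E (fun t => c (phi t))).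
Qed.

(** The interval may be empty, hence the classical case split and the arbitrary value 0 in that
    case. *)
Lemma constant_on (a b : Rbar) (f : R -> R) :
  (forall t, in_itv a b t -> is_derive f t 0) ->
  exists k, forall t, in_itv a b t -> f t = k.
Proof.
  intros Hf; destruct (classic (exists t0, in_itv a b t0)) as [[t0 H0] | H0].
  - exists (f t0); intros t Ht; now apply (constant_on_of_derive_0 a b).
  - exists 0; intros t Ht; elim H0; now exists t.
Qed.

(** * Comparison of the Frenet frames of a Bertrand pair *)

Section Bertrand.

Variables (a b a' b' : Rbar) (c d : R -> vec3) (phi : R -> R).
Variables (lambda eps : R).
Hypothesis Hc : arclength_curve_on a b c.
Hypothesis Hd : arclength_curve_on a' b' d.
Hypothesis phi_maps : forall s, in_itv a b s -> in_itv a' b' (phi s).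
Hypothesis phi_cont : forall s, in_itv a b s -> continuous phi s.
Hypothesis eps_sqr : eps * eps = 1.
Hypothesis normal_eq :
  forall s, in_itv a b s -> normal c s = scal eps (normal d (phi s)).
Hypothesis mate_eq :
  forall s, in_itv a b s -> d (phi s) = plus (c s) (scal lambda (normal c s)).

Let k := curvature c.
Let w := torsion c.
Let kd := curvature d.
Let wd := torsion d.
(** The rate [ds*/ds], negative when the correspondence reverses orientation. *)
Let p (s : R) : R := Derive phi s.

Lemma mate_is_vderive (s : R) :
  in_itv a b s ->
  is_vderive (fun t => d (phi t)) s
    (plus (scal (1 - lambda * k s) (tangent c s))
       (scal (lambda * w s) (binormal c s))).
Proof.
  intros Hs.
  apply (is_vderive_ext_on a b (fun t => plus (c t) (scal lambda (normal c t))));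
    [| exact Hs |].
  - intros t Ht; now rewrite mate_eq.
  - pose proof (is_vderive_plus _ _ s _ _
      (arclength_is_vderive a b c Hc s Hs)
      (is_vderive_scal (fun _ => lambda) _ s 0 _ (is_derive_const lambda s)
        (frenet_N a b c Hc s Hs))) as H.
    match type of H with is_vderive _ _ ?x => match goal with
      |- is_vderive _ _ ?y => replace y with x; [exact H |] end end.
    fold k w; apply vec3_eq; vexpand; ring.
Qed.

(** [phi] is only assumed continuous; its derivative comes from the mate equation, which makes
    [d (phi t)] differentiable, and the unit speed of [d]. *)
Lemma correspondence_is_derive (s : R) :
  in_itv a b s -> is_derive phi s (p s).
Proof.
  intros Hs; apply Derive_correct; eexists.
  apply (is_vderive_comp_inv d phi s (tangent d (phi s))).
  - now apply phi_cont.
  - now apply (arclength_is_vderive a' b'), phi_maps.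
  - now apply (tangent_unit a' b'), phi_maps.
  - now apply mate_is_vderive.
Qed.

(** Both sides are the velocity of [d (phi t)]: one by the mate equation, the other by the chain
    rule. *)
Lemma mate_tangent_eq (s : R) :
  in_itv a b s ->
  plus (scal (1 - lambda * k s) (tangent c s))
    (scal (lambda * w s) (binormal c s)) = scal (p s) (tangent d (phi s)).
Proof.
  intros Hs; rewrite <- (is_vderive_unique _ _ _ (mate_is_vderive s Hs)).
  apply is_vderive_unique, is_vderive_comp.
  - now apply (arclength_is_vderive a' b'), phi_maps.
  - now apply correspondence_is_derive.
Qed.

(** Both sides are the derivative of [normal c], computed directly and through [normal_eq]. *)
Lemma mate_normal_eq (s : R) :
  in_itv a b s ->
  plus (scal (- k s) (tangent c s)) (scal (w s) (binormal c s)) =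
    scal (eps * p s) (plus (scal (- kd (phi s)) (tangent d (phi s)))
                        (scal (wd (phi s)) (binormal d (phi s)))).
Proof.
  intros Hs; unfold k, w.
  rewrite <- (is_vderive_unique _ _ _ (frenet_N a b c Hc s Hs)).
  rewrite (vDerive_ext_on a b (normal c)
    (fun t => scal eps (normal d (phi t)))) by (exact normal_eq || exact Hs).
  apply is_vderive_unique.
  pose proof (is_vderive_scal (fun _ => eps) _ s 0 _ (is_derive_const eps s)
    (is_vderive_comp (normal d) phi s _ _
      (frenet_N a' b' d Hd (phi s) (phi_maps s Hs))
      (correspondence_is_derive s Hs))) as H.
  match type of H with is_vderive _ _ ?x => match goal with
    |- is_vderive _ _ ?y => replace y with x; [exact H |] end end.
  fold kd wd; apply vec3_eq; vexpand; ring.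
Qed.

(** [C] and [S] are the cosine and signed sine of the angle between the two tangents, measured in
    the plane of [tangent c] and [binormal c]. *)
Let C (s : R) : R := dot (tangent d (phi s)) (tangent c s).
Let S (s : R) : R := dot (tangent d (phi s)) (binormal c s).

Lemma dot_mate_tangent_normal (s : R) :
  in_itv a b s -> dot (tangent d (phi s)) (normal c s) = 0.
Proof.
  intros Hs; rewrite normal_eq, dot_scal_r by exact Hs.
  rewrite (dot_tangent_normal a' b' d Hd) by now apply phi_maps.
  ring.
Qed.

Lemma dot_tangent_mate_normal (s : R) :
  in_itv a b s -> dot (normal d (phi s)) (tangent c s) = 0.
Proof.
  intros Hs; pose proof (dot_tangent_normal a b c Hc s Hs) as H.
  rewrite normal_eq, dot_scal_r, dot_comm in H by exact Hs; nra.
Qed.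

Lemma dot_mate_normal_binormal (s : R) :
  in_itv a b s -> dot (normal d (phi s)) (binormal c s) = 0.
Proof.
  intros Hs; pose proof (dot_normal_binormal c s) as H.
  rewrite normal_eq, dot_scal_l in H by exact Hs; nra.
Qed.

Lemma mate_tangent_expand (s : R) :
  in_itv a b s ->
  tangent d (phi s) =
    plus (scal (C s) (tangent c s)) (scal (S s) (binormal c s)).
Proof.
  intros Hs.
  rewrite (frame_expand (tangent c s) (normal c s) (tangent d (phi s))).
  - rewrite dot_mate_tangent_normal by exact Hs.
    change (cross (tangent c s) (normal c s)) with (binormal c s).
    fold (C s) (S s); apply vec3_eq; vexpand; ring.
  - now apply (tangent_unit a b).
  - now apply (normal_unit a b).
  - now apply (dot_tangent_normal a b).
Qed.

Lemma mate_binormal_expand (s : R) :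
  in_itv a b s ->
  binormal d (phi s) =
    scal eps (plus (scal (- S s) (tangent c s)) (scal (C s) (binormal c s))).
Proof.
  intros Hs; unfold binormal at 1.
  (* Since [eps] is its own inverse, [normal_eq] can be solved for the normal of the mate. *)
  replace (normal d (phi s)) with (scal eps (normal c s)).
  2:{ rewrite normal_eq by exact Hs.
      apply vec3_eq; rewrite ?cx_scal, ?cy_scal, ?cz_scal, <- Rmult_assoc,
        eps_sqr; ring. }
  rewrite mate_tangent_expand by exact Hs.
  replace (cross _ _) with
    (scal eps (plus (scal (C s) (cross (tangent c s) (normal c s)))
      (scal (S s) (cross (binormal c s) (normal c s)))))
    by (apply vec3_eq; vexpand; ring).
  unfold binormal at 1; rewrite cross_cross_l.
  rewrite (dot_tangent_normal a b c Hc), (normal_unit a b c Hc) by exact Hs.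
  change (cross (tangent c s) (normal c s)) with (binormal c s).
  apply vec3_eq; vexpand; ring.
Qed.

Lemma frame_coord (s x y z t : R) :
  in_itv a b s ->
  plus (scal x (tangent c s)) (scal y (binormal c s)) =
    plus (scal z (tangent c s)) (scal t (binormal c s)) ->
  x = z /\ y = t.
Proof.
  intros Hs H.
  pose proof (f_equal (fun v => dot v (tangent c s)) H) as HT.
  pose proof (f_equal (fun v => dot v (binormal c s)) H) as HB.
  cbv beta in HT, HB; rewrite !dot_plus_l, !dot_scal_l in HT, HB.
  rewrite (dot_comm (binormal c s)), (dot_tangent_binormal c),
    (tangent_unit a b c Hc) in HT by exact Hs.
  rewrite (dot_tangent_binormal c), (binormal_unit a b c Hc) in HB
    by exact Hs.
  lra.
Qed.

Lemma angle_unit (s : R) : in_itv a b s -> C s * C s + S s * S s = 1.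
Proof.
  intros Hs.
  rewrite <- (tangent_unit a' b' d Hd (phi s)) by now apply phi_maps.
  rewrite mate_tangent_expand by exact Hs.
  rewrite !dot_plus_l, !dot_plus_r, !dot_scal_l, !dot_scal_r.
  rewrite (dot_comm (binormal c s) (tangent c s)), (dot_tangent_binormal c),
    (binormal_unit a b c Hc), (tangent_unit a b c Hc) by exact Hs.
  ring.
Qed.

Lemma bertrand_tangent_coord (s : R) :
  in_itv a b s -> 1 - lambda * k s = p s * C s /\ lambda * w s = p s * S s.
Proof.
  intros Hs; apply (frame_coord s); [exact Hs |].
  rewrite mate_tangent_eq, mate_tangent_expand by exact Hs.
  apply vec3_eq; vexpand; ring.
Qed.

Lemma bertrand_normal_coord (s : R) :
  in_itv a b s ->
  k s = p s * (eps * C s * kd (phi s) + S s * wd (phi s)) /\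
  w s = p s * (C s * wd (phi s) - eps * S s * kd (phi s)).
Proof.
  intros Hs.
  assert (E : - k s = - (p s * (eps * C s * kd (phi s) + S s * wd (phi s))) /\
    w s = p s * (C s * wd (phi s) - eps * S s * kd (phi s))).
  { apply (frame_coord s); [exact Hs |].
    rewrite mate_normal_eq, mate_tangent_expand, mate_binormal_expand
      by exact Hs.
    (* One coordinate of the vector identity, [x] and [y] standing for those of [tangent c] and
       [binormal c]. The factor [eps * eps] is kept visible so that it can be rewritten to 1. *)
    assert (E : forall x y, eps * p s *
        (- kd (phi s) * (C s * x + S s * y) +
         wd (phi s) * (eps * (- S s * x + C s * y))) =
        - (p s * (eps * C s * kd (phi s) + (eps * eps) * S s * wd (phi s))) * x +
        p s * ((eps * eps) * C s * wd (phi s) - eps * S s * kd (phi s)) * y)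
      by (intros; ring).
    rewrite eps_sqr in E.
    apply vec3_eq; vexpand; rewrite E; ring. }
  lra.
Qed.

(** All of [T'], [B'] and the derivative of the mate tangent point along the common normal line,
    which is orthogonal to each vector they are paired with. *)
Lemma angle_is_derive (s : R) :
  in_itv a b s -> is_derive C s 0 /\ is_derive S s 0.
Proof.
  intros Hs.
  pose proof (is_vderive_comp (tangent d) phi s _ _
    (frenet_T a' b' d Hd (phi s) (phi_maps s Hs))
    (correspondence_is_derive s Hs)) as H.
  split.
  - pose proof (is_derive_dot _ _ s _ _ H (frenet_T a b c Hc s Hs)) as H'.
    cbv beta in H'; rewrite !dot_scal_l, dot_scal_r in H'.
    rewrite dot_tangent_mate_normal, dot_mate_tangent_normal, !Rmult_0_r,
      Rplus_0_r in H' by exact Hs; exact H'.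
  - pose proof (is_derive_dot _ _ s _ _ H (frenet_B a b c Hc s Hs)) as H'.
    cbv beta in H'; rewrite !dot_scal_l, dot_scal_r in H'.
    rewrite dot_mate_normal_binormal, dot_mate_tangent_normal, !Rmult_0_r,
      Rplus_0_r in H' by exact Hs; exact H'.
Qed.

(** The constants are chosen before [s]. Their normalisation stands under the quantifier because on
    an empty interval they are arbitrary. *)
Lemma bertrand_constant_angle :
  exists C0 S0, forall s, in_itv a b s -> exists p,
    C0 * C0 + S0 * S0 = 1 /\ is_derive phi s p /\
    lambda * w s = p * S0 /\
    k s = p * (eps * C0 * kd (phi s) + S0 * wd (phi s)) /\
    w s = p * (C0 * wd (phi s) - eps * S0 * kd (phi s)).
Proof.
  destruct (constant_on a b C) as [C0 HC].
  { intros s Hs; now apply angle_is_derive. }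
  destruct (constant_on a b S) as [S0 HS].
  { intros s Hs; now apply angle_is_derive. }
  exists C0, S0; intros s Hs; exists (p s).
  rewrite <- (HC s Hs), <- (HS s Hs).
  split; [now apply angle_unit |].
  split; [now apply correspondence_is_derive |].
  split; [now apply bertrand_tangent_coord | now apply bertrand_normal_coord].
Qed.

End Bertrand.

(** * The indicatrix ratio expressed through the mate *)

(** The sign of [p] enters once through the torsion sign and once through [p ^ 3 / Rabs p ^ 3], so
    the orientation of the correspondence cancels. *)
Lemma sign_ratio_collapse (p m e V : R) :
  p <> 0 -> m <> 0 -> V <> 0 ->
  (p * m) / Rabs (p * m) * (m * p ^ 3 * e) / (Rabs p * V) ^ 3 =
    Rabs m * e / V ^ 3.
Proof.
  intros Hp Hm HV; rewrite Rabs_mult.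
  unfold Rabs; destruct (Rcase_abs p), (Rcase_abs m); field; auto.
Qed.

Lemma affine_relation_derive (a b : Rbar) (f g : R -> R) (x y l : R) (t : R) :
  (forall u, in_itv a b u -> x * f u - y * g u = l) -> in_itv a b t ->
  ex_derive f t -> ex_derive g t -> x * Derive f t = y * Derive g t.
Proof.
  intros H Ht Hf Hg.
  assert (E : Derive (fun u => x * f u - y * g u) t = 0).
  { rewrite <- (Derive_const l t); apply Derive_ext_loc.
    now apply (locally_on a b). }
  rewrite Derive_minus, !Derive_scal in E; [lra | |];
    now apply ex_derive_scal.
Qed.

(** The pair [(k, w)] is [p] times a rotation of [(eps * kd, wd)]. *)
Lemma darboux_transport (k w kd wd p C S eps : R) :
  eps * eps = 1 -> C * C + S * S = 1 ->
  k = p * (eps * C * kd + S * wd) -> w = p * (C * wd - eps * S * kd) ->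
  sqrt (k * k + w * w) = Rabs p * sqrt (kd * kd + wd * wd).
Proof.
  intros He HCS -> ->.
  rewrite <- sqrt_Rsqr_abs, <- sqrt_mult_alt by apply Rle_0_sqr.
  f_equal; unfold Rsqr.
  replace (p * (eps * C * kd + S * wd) * (p * (eps * C * kd + S * wd)) +
    p * (C * wd - eps * S * kd) * (p * (C * wd - eps * S * kd))) with
    (p * p * ((eps * eps) * (C * C + S * S) * (kd * kd)
      + (C * C + S * S) * (wd * wd))) by ring.
  rewrite He, HCS; ring.
Qed.

(** With [Q = eps C kd + S wd], differentiating the relation [S k = lambda w Q(phi)] rather than
    [k = p Q(phi)] avoids a second derivative of [phi]. *)
Lemma binormal_ratio_mate (a b : Rbar) (c : R -> vec3) (phi kd wd : R -> R)
    (lambda eps C S p s : R) :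
  arclength_curve_on a b c ->
  (forall t, in_itv a b t -> torsion c t <> 0) -> in_itv a b s ->
  lambda <> 0 -> eps * eps = 1 -> C * C + S * S = 1 -> C <> 0 -> S <> 0 ->
  ex_derive kd (phi s) -> ex_derive wd (phi s) ->
  C * Derive wd (phi s) = eps * S * Derive kd (phi s) ->
  is_derive phi s p ->
  lambda * torsion c s = p * S ->
  curvature c s = p * (eps * C * kd (phi s) + S * wd (phi s)) ->
  torsion c s = p * (C * wd (phi s) - eps * S * kd (phi s)) ->
  (forall t, in_itv a b t -> S * curvature c t =
     lambda * (torsion c t * (eps * C * kd (phi t) + S * wd (phi t)))) ->
  torsion (binormal c) s / curvature (binormal c) s =
    Rabs (S / lambda) * (eps / C) *
    (Derive kd (phi s)
      / sqrt (kd (phi s) * kd (phi s) + wd (phi s) * wd (phi s)) ^ 3).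
Proof.
  intros Hc Hw Hs Hl He HCS HC HS Hkd Hwd Hrel Hphi E1 E2 E3 Hk.
  rewrite (binormal_torsion_ratio a b c Hc Hw s Hs).
  rewrite (darboux_transport _ _ (kd (phi s)) (wd (phi s)) p C S eps);
    try assumption.
  pose proof (smooth_on_ex_derive a b _ s (smooth_on_torsion a b c Hc) Hs)
    as Hdw.
  pose proof (Hw s Hs) as Hw0.
  assert (Hp : p <> 0).
  { intros ->; apply Hw0; rewrite E3; ring. }
  set (Q := fun u => eps * C * kd u + S * wd u).
  (* By [Hrel], [wd'] is [eps S / C] times [kd']; then [C * C + S * S = 1] collapses the sum. *)
  assert (HQ : is_derive Q (phi s) (eps / C * Derive kd (phi s))).
  { replace (eps / C * Derive kd (phi s)) with
      (eps * C * Derive kd (phi s) + S * Derive wd (phi s)).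
    - apply (is_derive_plus_R (fun u => eps * C * kd u) (fun u => S * wd u));
        apply is_derive_scal; now apply Derive_correct.
    - apply (Rmult_eq_reg_l C); [| exact HC].
      replace (C * (eps * C * Derive kd (phi s) + S * Derive wd (phi s))) with
        (eps * (C * C) * Derive kd (phi s) + S * (C * Derive wd (phi s)))
        by ring.
      rewrite Hrel.
      replace (C * (eps / C * Derive kd (phi s))) with
        (eps * (C * C + S * S) * Derive kd (phi s))
        by (rewrite HCS; field; exact HC).
      ring. }
  assert (Hdk : Derive (curvature c) s = lambda / S *
    (Derive (torsion c) s * Q (phi s)
      + torsion c s * (p * (eps / C * Derive kd (phi s))))).
  { apply is_derive_unique.
    apply (is_derive_ext_loc
      (fun t => lambda / S * (torsion c t * Q (phi t)))).
    - apply (locally_on a b); [| exact Hs]; intros t Ht.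
      apply (Rmult_eq_reg_l S); [| exact HS]; rewrite (Hk t Ht).
      unfold Q; field; exact HS.
    - apply is_derive_scal.
      apply (is_derive_mult_R (torsion c) (fun t => Q (phi t))).
      + now apply Derive_correct.
      + now apply (is_derive_comp Q phi). }
  set (m := S / lambda).
  assert (Hm : m <> 0) by (unfold m, Rdiv;
    apply Rmult_integral_contrapositive; auto using Rinv_neq_0_compat).
  assert (Em : torsion c s = p * m).
  { apply (Rmult_eq_reg_l lambda); [| exact Hl]; rewrite E1.
    unfold m; field; exact Hl. }
  (* The terms in [w'] cancel, leaving [lambda / S] times [w ^ 2 * p * Q'], where [w = p * m] and
     [m = S / lambda]. *)
  replace (Derive (curvature c) s * torsion c s
           - Derive (torsion c) s * curvature c s)
    with (m * p ^ 3 * (eps / C * Derive kd (phi s))).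
  - rewrite Em, sign_ratio_collapse; try assumption.
    + unfold Rdiv; ring.
    + apply Rgt_not_eq, sqrt_lt_R0.
      (* A zero radicand would force [kd], [wd] and hence the torsion of [c] to vanish here. *)
      assert (HV : 0 <= kd (phi s) * kd (phi s) + wd (phi s) * wd (phi s))
        by nra.
      destruct HV as [HV | HV]; [exact HV |].
      assert (Hk0 : kd (phi s) = 0) by nra.
      assert (Hwd0 : wd (phi s) = 0) by nra.
      elim Hw0; rewrite E3, Hk0, Hwd0; ring.
  - rewrite Hdk; fold (Q (phi s)) in E2.
    rewrite E2, Em; unfold m; field; auto.
Qed.

(** Here [g] is [w' / k']. The quotient rule gives the numerator [k2 (k^2 + w^2) - 3 k'^2 (k + g w)]
    over the fifth power of the root; extracting [k] produces the displayed expression in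
    [w / k]. *)
Lemma is_derive_mate_ratio (k w : R -> R) (u g k2 : R) :
  0 < k u -> is_derive (Derive k) u k2 -> ex_derive k u ->
  is_derive w u (g * Derive k u) ->
  is_derive
    (fun t => Derive k t / sqrt (k t * k t + w t * w t) ^ 3) u
    (k u * (k2 * k u * (w u / k u) ^ 2 - 3 * Derive k u ^ 2 * g * (w u / k u)
            + k2 * k u - 3 * Derive k u ^ 2)
       / sqrt (k u * k u + w u * w u) ^ 5).
Proof.
  intros Hk Hk2 Hk1 Hw.
  apply Derive_correct in Hk1.
  assert (HV : 0 < k u * k u + w u * w u) by nra.
  pose proof (sqrt_lt_R0 _ HV) as HW.
  pose proof (is_derive_plus_R _ _ u _ _
    (is_derive_mult_R _ _ u _ _ Hk1 Hk1)
    (is_derive_mult_R _ _ u _ _ Hw Hw)) as H1.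
  pose proof (is_derive_pow _ 3 u _ (is_derive_sqrt _ u _ H1 HV)) as H2.
  pose proof (is_derive_div _ _ u _ _ Hk2 H2) as H3.
  match type of H3 with ?A -> is_derive _ _ ?x => assert (H4 : A) end.
  { apply pow_nonzero; lra. }
  specialize (H3 H4); cbv beta in H3.
  match type of H3 with is_derive _ _ ?x => match goal with
    |- is_derive _ _ ?y => replace y with x; [exact H3 |] end end.
  pose proof (sqrt_sqrt _ (Rlt_le _ _ HV)) as HS.
  set (V := sqrt (k u * k u + w u * w u)) in *.
  simpl (Init.Nat.pred 3); simpl INR.
  apply (Rmult_eq_reg_r (V ^ 5)); [| apply pow_nonzero; lra].
  (* The middle form contains the root only as [V * V], which [HS] turns into a polynomial. *)
  transitivity (k2 * (V * V) - 3 * Derive k u *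
    (k u * Derive k u + w u * (g * Derive k u))).
  - field; lra.
  - rewrite HS; field; split; lra.
Qed.

(** * Helices among indicatrices and the differential equation of the mate *)

Theorem theorem14 (a b a' b' : Rbar) (gamma gammat : R -> vec3) :
  let kt := curvature gammat in
  let tt := torsion gammat in
  let ft := fun u => tt u / kt u in
  let gt := fun u => Derive tt u / Derive kt u in
  arclength_curve_on a b gamma ->
  arclength_curve_on a' b' gammat ->
  bertrand_pair a b gamma a' b' gammat ->
  ~ general_helix a b gamma ->
  ~ general_helix a' b' gammat ->
  (forall s, in_itv a b s -> torsion gamma s <> 0) ->
  (forall u, in_itv a' b' u -> torsion gammat u <> 0) ->
  (forall u, in_itv a' b' u -> Derive kt u <> 0) ->
  (forall u, in_itv a' b' u -> ft u <> 0) ->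
  (forall u, in_itv a' b' u -> gt u <> ft u) ->
  spherical_helix a b (binormal gamma) <->
  (forall u, in_itv a' b' u ->
     Derive_n kt 2 u * kt u * ft u ^ 2
     - 3 * Derive kt u ^ 2 * gt u * ft u
     + Derive_n kt 2 u * kt u
     - 3 * Derive kt u ^ 2 = 0).
Proof.
  intros kt tt ft gt Hc Hd HB _ _ Hw _ Hk1 _ _.
  destruct HB as (phi & lambda & eps & Hmaps & _ & Hsurj & Hcont & Hl & He & Hm).
  assert (He2 : eps * eps = 1) by (destruct He; subst eps; ring).
  destruct (bertrand_constant_angle a b a' b' gamma gammat phi lambda eps
    Hc Hd Hmaps Hcont He2 (fun s Hs => proj1 (Hm s Hs))
    (fun s Hs => proj2 (Hm s Hs))) as (C & S & HCS).
  assert (Hdk : forall u, in_itv a' b' u -> ex_derive kt u).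
  { intros u Hu; apply (smooth_on_ex_derive a' b'); [| exact Hu].
    now apply smooth_on_curvature. }
  assert (Hdw : forall u, in_itv a' b' u -> ex_derive tt u).
  { intros u Hu; apply (smooth_on_ex_derive a' b'); [| exact Hu].
    now apply smooth_on_torsion. }
  assert (HS : forall s, in_itv a b s -> S <> 0).
  { intros s Hs ->; destruct (HCS s Hs) as (p & _ & _ & E & _).
    apply (Hw s Hs), (Rmult_eq_reg_l lambda); [| exact Hl].
    rewrite E; ring. }
  (* Eliminate the torsion of [gamma] between its two expressions and cancel [p], nonzero because
     that torsion is; surjectivity of [phi] reaches every [u]. *)
  assert (Haff : forall u, in_itv a' b' u ->
    C * tt u - eps * S * kt u = S / lambda).
  { intros u Hu; destruct (Hsurj u Hu) as (s & Hs & <-).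
    destruct (HCS s Hs) as (p & _ & _ & E & _ & E').
    assert (Hp : p <> 0).
    { intros ->; apply (Hw s Hs); rewrite E'; ring. }
    apply (Rmult_eq_reg_l (lambda * p)).
    - transitivity (lambda * (p * (C * tt (phi s) - eps * S * kt (phi s))));
        [ring |].
      unfold tt, kt; rewrite <- E', E; field; exact Hl.
    - now apply Rmult_integral_contrapositive. }
  assert (Hrel : forall u, in_itv a' b' u ->
    C * Derive tt u = eps * S * Derive kt u).
  { intros u Hu; apply (affine_relation_derive a' b' _ _ _ _ (S / lambda));
      auto. }
  (* If [C] were 0, [Hrel] would give [eps * S * Derive kt u = 0], although all three factors are
     nonzero. *)
  assert (HC : forall u, in_itv a' b' u -> C <> 0).
  { intros u Hu HC0; pose proof (Hrel u Hu) as H; rewrite HC0 in H.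
    destruct (Hsurj u Hu) as (s & Hs & _).
    pose proof (HS s Hs) as HS0; pose proof (Hk1 u Hu) as Hk0.
    assert (H1 : S * Derive kt u = 0).
    { replace (S * Derive kt u) with (eps * eps * (S * Derive kt u))
        by (rewrite He2; ring).
      replace (eps * eps * (S * Derive kt u)) with
        (eps * (eps * S * Derive kt u)) by ring.
      rewrite <- H; ring. }
    apply Rmult_integral in H1; tauto. }
  set (H := fun u => Derive kt u / sqrt (kt u * kt u + tt u * tt u) ^ 3).
  (* Where C or S vanishes, both intervals are empty and K is irrelevant. *)
  set (K := Rabs (S / lambda) * (eps / C)).
  assert (Hratio : forall s, in_itv a b s ->
    torsion (binormal gamma) s / curvature (binormal gamma) s = K * H (phi s)).
  { intros s Hs; destruct (HCS s Hs) as (p & E0 & E1 & E2 & E3 & E4).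
    pose proof (Hmaps s Hs) as Hu.
    apply (binormal_ratio_mate a b gamma phi kt tt lambda eps C S p s);
      eauto.
    (* Multiplying the curvature formula by [S] and replacing [pt * S] by [lambda] times the torsion
       eliminates [pt]. *)
    intros t Ht; destruct (HCS t Ht) as (pt & _ & _ & F1 & F2 & _).
    rewrite F2, <- (Rmult_assoc lambda), F1; unfold kt, tt; ring. }
  assert (HH : forall u, in_itv a' b' u -> is_derive H u
    (kt u * (Derive_n kt 2 u * kt u * ft u ^ 2
             - 3 * Derive kt u ^ 2 * gt u * ft u
             + Derive_n kt 2 u * kt u - 3 * Derive kt u ^ 2)
       / sqrt (kt u * kt u + tt u * tt u) ^ 5)).
  { intros u Hu; apply is_derive_mate_ratio.
    - now apply (curvature_pos a' b').
    - apply Derive_correct, (smooth_on_ex_derive a' b'); [| exact Hu].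
      now apply smooth_on_Derive, smooth_on_curvature.
    - now apply Hdk.
    - replace (gt u * Derive kt u) with (Derive tt u)
        by (unfold gt; field; now apply Hk1).
      now apply Derive_correct, Hdw. }
  split.
  (* A constant ratio [k0] makes [H] equal to [k0 / K] on the whole mate interval, by surjectivity.
     So [H'] vanishes there, and its factors [kt u] and the inverse fifth power are nonzero. *)
  - intros (_ & _ & k0 & Hk0) u Hu.
    destruct (Hsurj u Hu) as (s0 & Hs0 & _).
    assert (HK : K <> 0).
    { pose proof (HS s0 Hs0); pose proof (HC u Hu).
      assert (eps <> 0) by (intros ->; lra).
      unfold K, Rdiv; repeat (apply Rmult_integral_contrapositive; split);
        try apply Rabs_no_R0, Rmult_integral_contrapositive;
        auto using Rinv_neq_0_compat. }
    assert (Hconst : is_derive H u 0).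
    { apply (is_derive_ext_loc (fun _ => k0 / K));
        [| apply (is_derive_const (k0 / K))].
      apply (locally_on a' b'); [| exact Hu].
      intros v Hv; destruct (Hsurj v Hv) as (s & Hs & <-).
      assert (E : k0 / K = H (phi s)); [| exact E].
      rewrite <- (Hk0 s Hs), (Hratio s Hs); field; exact HK. }
    pose proof (is_derive_unique _ _ _ Hconst) as E.
    rewrite (is_derive_unique _ _ _ (HH u Hu)) in E.
    pose proof (curvature_pos a' b' gammat Hd u Hu) as Hk; fold kt in Hk.
    assert (HV : sqrt (kt u * kt u + tt u * tt u) ^ 5 <> 0).
    { apply pow_nonzero, Rgt_not_eq, sqrt_lt_R0; nra. }
    unfold Rdiv at 1 in E.
    apply Rmult_integral in E; destruct E as [E | E].
    + apply Rmult_integral in E; destruct E as [E | E]; [lra | exact E].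
    + now elim (Rinv_neq_0_compat _ HV).
  (* Conversely the equation gives [H' = 0], so [H] is constant on the mate interval and the ratio
     is constant through [phi]. *)
  - intros Heq; split.
    + intros t Ht; unfold enorm.
      rewrite (binormal_unit a b gamma Hc t Ht); apply sqrt_1.
    + split; [now apply curve_on_binormal |].
      destruct (constant_on a' b' H) as [h Hh].
      { intros u Hu; pose proof (HH u Hu) as E; rewrite (Heq u Hu) in E.
        rewrite Rmult_0_r in E; unfold Rdiv at 1 in E.
        now rewrite Rmult_0_l in E. }
      exists (K * h); intros t Ht.
      rewrite (Hratio t Ht), Hh; [reflexivity | now apply Hmaps].
Qed.
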